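(* Let $k \geq 1$ be an integer and $d \in \{2k, 2k+1\}$ with $d \geq 3$. Then $lb_W(B_d) - lb(B_d) > 0$.
   Context: For a tree $T$ of order $n$: $d(u,v)$ is the distance. Weight centers: for $v\in V(T)$ let $w_T(v)=\sum_u d(u,v)$; the weight centers are the minimizers of $w_T$, $W(T)$ is their set (one or two adjacent vertices). $\zeta(T)=0$ if $|W(T)|=1$, $1$ if $|W(T)|=2$, $\zeta'(T)=1-\zeta(T)$; $\mathcal{L}_W(T)=\sum_{u}\min\{d(u,x):x\in W(T)\}$. The center $C(T)$ is the set of vertices of minimum eccentricity (one vertex or two adjacent vertices); $\varepsilon(T)=0$ if $|C(T)|=1$, $1$ if $|C(T)|=2$, $\varepsilon'(T)=1-\varepsilon(T)$; $\mathcal{L}(T)=\sum_u\min\{d(u,x):x\in C(T)\}$. Define $lb_W(T)=(n-1)(n-1-\zeta(T))+\zeta'(T)-2\mathcal{L}_W(T)$ and $lb(T)=(n-1)(n-1-\varepsilon(T))+\varepsilon'(T)-2\mathcal{L}(T)$. The broom $B_{n,d}$ is the tree on $n$ vertices consisting of a path on $d$ vertices together with $n-d$ additional vertices all adjacent to the same end vertex of the path; $B_{2k}=B_{k(2k+1),\,2k}$ and $B_{2k+1}=B_{(k+1)(2k+1),\,2k+1}$. *)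

(* Defs.v *)
From mathcomp Require Import all_boot all_order all_algebra.

Set Implicit Arguments.
Unset Strict Implicit.
Unset Printing Implicit Defensive.

Section GraphParameters.

(* A graph is its adjacency relation on a finite vertex type. *)
Variables (T : finType) (e : rel T).

Definition walk (k : nat) (u v : T) : bool :=
  [exists p : k.-tuple T, path e u p && (last u p == v)].

(* The least length of a walk from u to v; it is #|T|, larger than any distance
   in a connected graph, when there is no walk. *)
Definition dist (u v : T) : nat :=
  find (fun k => walk k u v) (iota 0 #|T|).

Definition weight (v : T) : nat := \sum_(u : T) dist u v.

Definition weight_centers : {set T} :=
  [set v | [forall u, weight v <= weight u]].

Definition ecc (v : T) : nat := \max_(u : T) dist u v.

Definition center : {set T} := [set v | [forall u, ecc v <= ecc u]].

(* The parameters below are shared by the two kinds of center S.  For a tree,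
   S is one vertex or two adjacent vertices. *)
Definition bicentral (S : {set T}) : nat := (#|S| == 2).

(* The default value #|T| of the minimum is not reached when S is nonempty
   and the graph is connected. *)
Definition level_sum (S : {set T}) : nat :=
  \sum_(u : T) \big[minn/#|T|]_(x in S) dist u x.

Definition lower_bound (S : {set T}) : int :=
  let n : int := Posz #|T| in
  let z : int := Posz (bicentral S) in
  ((n - 1) * (n - 1 - z) + (1 - z) - 2 * Posz (level_sum S))%R.

Definition lbW : int := lower_bound weight_centers.

Definition lb : int := lower_bound center.

End GraphParameters.

(* Vertices 0, ..., d-1 form the path, and the vertices d, ..., n-1 are all
   attached to its end d-1 (this needs 0 < d <= n). *)
Definition broom (n d : nat) : rel 'I_n :=
  let arc (i j : 'I_n) := if j < d then i.+1 == j else i.+1 == d in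
  fun i j => arc i j || arc j i.
Arguments broom : clear implicits.

(* k(2k+1) for d = 2k, and (k+1)(2k+1) for d = 2k+1. *)
Definition order_broomB (d : nat) : nat :=
  if odd d then (d./2 + 1) * (2 * d./2 + 1) else d./2 * (2 * d./2 + 1).

Definition broomB (d : nat) : rel 'I_(order_broomB d) :=
  broom (order_broomB d) d.
Arguments broomB : clear implicits.

(* Main.v *)
Require Import Defs.
From mathcomp Require Import all_boot all_order all_algebra.
From mathcomp Require Import zify.

(** Write d = 2k + e with e in {0, 1}.  The order of B_d is n = d(d+1)/2, so the
    end d-1 of the path together with its leaves makes up more than half of the
    vertices; hence d-1 is the unique weight center, and L_W = d(d-1).  The center consists
    of the path vertices v with k <= v <= k + e, every leaf is at distance k
    from it, and L >= k^2 + (n-d)k.  The difference of the two bounds is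
    e n + 2 (L - L_W), and already this lower bound for L makes it positive. *)

Set Implicit Arguments.
Unset Strict Implicit.
Unset Printing Implicit Defensive.

(** * Distances certified by a potential function *)

Section DistancePotential.

Variables (T : finType) (e : rel T) (v : T) (g : T -> nat).

Hypothesis g_target : g v = 0.
Hypothesis g_lip : forall x y, e x y -> g x <= (g y).+1.
Hypothesis g_descent :
  forall x, x != v -> exists2 y, e x y & g x = (g y).+1.

Lemma potential_le_walk k u : walk e k u v -> g u <= k.
Proof.
move=> /existsP[p /andP[pp /eqP lp]].
have -> : k = size p by rewrite size_tuple.
move: (tval p) pp lp => {k}p; elim: p u => [|x p IH] u /=.
  by move=> _ ->; rewrite g_target.
by move=> /andP[/g_lip eux pp] lp; apply: leq_trans eux _; rewrite ltnS IH.
Qed.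

Lemma walk_potential u : walk e (g u) u v.
Proof.
have [k] := ubnP (g u); elim: k u => // k IH u guk.
have [->|/g_descent[y euy gu]] := eqVneq u v.
  by rewrite g_target; apply/existsP; exists [tuple]; rewrite /= eqxx.
have /existsP[p /andP[pp lp]] : walk e (g y) y v by apply: IH; lia.
by rewrite gu; apply/existsP; exists [tuple of y :: p]; rewrite /= euy pp.
Qed.

(** The Lipschitz condition bounds every walk to [v] from below, and following descents gives a walk
    of length [g u]. The bound by [#|T|] keeps that length in the range searched by [dist]. *)
Lemma dist_potential u : g u < #|T| -> dist e u v = g u.
Proof.
move=> gT; rewrite /dist.
set a := fun k => walk e k u v.
have ha : has a (iota 0 #|T|).
  by apply/hasP; exists (g u); rewrite ?mem_iota // /a walk_potential.
have lt_find := ha; rewrite has_find size_iota in lt_find.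
apply/eqP; rewrite eqn_leq; apply/andP; split; last first.
  by apply: potential_le_walk; have := nth_find 0 ha; rewrite nth_iota.
rewrite leqNgt; apply/negP => /(before_find 0).
by rewrite nth_iota // /a walk_potential.
Qed.

End DistancePotential.

(** [minn _ d] folds all leaves onto position d of a path 0, ..., d, where the distance is the
    absolute difference. Folding loses only the distance 2 between distinct leaves. *)
Definition broom_dist (d i j : nat) : nat :=
  if i == j then 0 else if (d <= i) && (d <= j) then 2
  else (minn i d - minn j d) + (minn j d - minn i d).

Ltac broom_dist_lia := rewrite ?/broom_dist; repeat case: ifP; lia.

Lemma dist_broom n d (u v : 'I_n) : 1 < d < n ->
  dist (broom n d) u v = broom_dist d u v.
Proof.
move=> /andP[d1 dn].
apply: (@dist_potential _ _ v (fun x : 'I_n => broom_dist d x v)).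
- by rewrite /broom_dist eqxx.
- by move=> x y; rewrite /broom; broom_dist_lia.
- move=> x xv; have {}xv : (x : nat) <> v by move/val_inj; apply/eqP.
  have := ltn_ord v; have := ltn_ord x.
  have step m (mn : m < n) :
      broom n d x (Ordinal mn) -> broom_dist d x v = (broom_dist d m v).+1 ->
      exists2 y, broom n d x y & broom_dist d x v = (broom_dist d y v).+1.
    by exists (Ordinal mn).
  (* The next vertex towards v: a leaf moves to d-1, a path vertex beyond v moves down, one before v
     moves up, and d-1 moves straight to the leaf v. *)
  have [dx|xd] := leqP d x.
    have mn : d.-1 < n by lia.
    by move=> *; apply: (step _ mn); rewrite ?/broom /=; broom_dist_lia.
  have [vx|xv'] := leqP v x.
    have mn : x.-1 < n by lia.
    by move=> *; apply: (step _ mn); rewrite ?/broom /=; broom_dist_lia.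
  have [dx|dx] := ltnP x.+1 d.
    have mn : x.+1 < n by lia.
    by move=> *; apply: (step _ mn); rewrite ?/broom /=; broom_dist_lia.
  by move=> *; apply: (step _ (ltn_ord v)); rewrite ?/broom /=; broom_dist_lia.
- by rewrite card_ord; broom_dist_lia.
Qed.

(** * Summation and a majority criterion for weights *)

Lemma sum_minn n d (F : nat -> nat) : d <= n ->
  \sum_(u < n) F (minn u d) = \sum_(i < d) F i + (n - d) * F d.
Proof.
move=> dn; rewrite -(big_mkord xpredT (fun u => F (minn u d))).
rewrite (@big_cat_nat _ _ _ d) //= big_mkord; congr (_ + _).
  by apply: eq_bigr => i _; congr F; have := ltn_ord i; lia.
rewrite (eq_big_nat _ _ (F2 := fun=> F d)); first by rewrite sum_nat_const_nat.
by move=> i /andP[di _]; congr F; lia.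
Qed.

Lemma double_sum_rev d : 2 * \sum_(i < d) (d.-1 - i) = d * d.-1.
Proof.
elim: d => [|d IH]; first by rewrite big_ord0.
rewrite big_ord_recl /= subn0 mulnDr.
rewrite (eq_bigr (fun i : 'I_d => d.-1 - i)) ?IH; last first.
  by move=> i _; rewrite /bump /=; lia.
by case: d {IH} => // d /=; lia.
Qed.

(** The summand is the distance from i to the interval [k, k+e]. Passing from k to k+1 adds two end
    positions, contributing k+1 and k. *)
Lemma sum_dist_middle k e :
  \sum_(i < 2 * k + e) ((k - i) + (i - (k + e))) = k * k.
Proof.
elim: k => [|k IH].
  by apply: big1 => i _; have := ltn_ord i; lia.
have -> : 2 * k.+1 + e = (2 * k + e).+2 by lia.
rewrite big_ord_recl big_ord_recr /=.
rewrite (eq_bigr (fun i : 'I_(2 * k + e) => (k - i) + (i - (k + e)))) ?IH.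
  by rewrite /bump /=; lia.
by move=> i _; rewrite /bump /=; lia.
Qed.

Lemma bigmin_ge (I : finType) (A : {set I}) (F : I -> nat) m0 m :
  m <= m0 -> (forall i, i \in A -> m <= F i) ->
  m <= \big[minn/m0]_(i in A) F i.
Proof.
by move=> m0P AP; elim/big_ind: _ => // x y mx my; rewrite leq_min mx.
Qed.

(** Moving from v to c saves at least t at each vertex outside B and costs at most t at each vertex
    of B, which is a minority. *)
Lemma weight_lt_minority (T : finType) (e : rel T) (c v : T) (B : {set T}) t :
  0 < t -> 2 * #|B| < #|T| ->
  (forall u, dist e u c + t * (u \notin B) <= dist e u v + t * (u \in B)) ->
  weight e c < weight e v.
Proof.
move=> t0 Bmin closer.
have sumB (A : {set T}) : \sum_u t * (u \in A) = t * #|A|.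
  rewrite -sum1_card big_distrr /= [RHS]big_mkcond /=.
  by apply: eq_bigr => u _; case: (u \in A); rewrite ?muln0.
have : weight e c + t * #|~: B| <= weight e v + t * #|B|.
  rewrite -!sumB /weight -!big_split /=; apply: leq_sum => u _.
  by rewrite inE closer.
have := cardsC B; nia.
Qed.

(** * Weight centers, center and level sums of a broom *)

Section Broom.

Variables (n d : nat).
Hypothesis d_gt1 : 1 < d.
Hypothesis d_ltn : d < n.

Lemma weight_broom_lt (c v : 'I_n) : 2 * d.-1 < n ->
  c = d.-1 :> nat -> v != c ->
  weight (broom n d) c < weight (broom n d) v.
Proof.
move=> dn2 cE /eqP vc; have {}vc : (v : nat) <> d.-1.
  by rewrite -cE => /val_inj.
have dnP : 1 < d < n by lia.
(* From a leaf v, moving to d-1 brings every vertex but v closer by 1. From a path vertex v, it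
   brings everything from d-1 onwards closer by d-1-v, so B is the rest of the path. *)
have [dv|vd] := leqP d v.
  apply: (@weight_lt_minority _ _ _ _ [set v] 1) => //.
    by rewrite cards1 card_ord; lia.
  move=> u; rewrite !dist_broom // cE in_set1 -(inj_eq val_inj) /=.
  by broom_dist_lia.
apply: (@weight_lt_minority _ _ _ _ [set u : 'I_n | u < d.-1] (d.-1 - v)).
- by lia.
- rewrite card_ord; apply: leq_ltn_trans dn2; rewrite leq_mul2l /=.
  rewrite cardsE cardE -(size_map val).
  rewrite -[X in _ <= X](size_iota 0); apply: uniq_leq_size.
    by rewrite map_inj_uniq ?enum_uniq //; apply: val_inj.
  by move=> _ /mapP[u + ->]; rewrite mem_enum mem_iota /=.
move=> u; rewrite !dist_broom // cE inE.
by case: (ltnP u d.-1) => /=; rewrite ?muln0 ?muln1; broom_dist_lia.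
Qed.

Lemma weight_centers_broom (c : 'I_n) : 2 * d.-1 < n -> c = d.-1 :> nat ->
  weight_centers (broom n d) = [set c].
Proof.
move=> dn2 cE; apply/setP => v; rewrite !inE.
have [->|vc] := eqVneq v c; last first.
  apply/negbTE/negP => /forallP/(_ c).
  by rewrite leqNgt weight_broom_lt.
apply/forallP => u; have [->//|uc] := eqVneq u c.
by rewrite ltnW // weight_broom_lt.
Qed.

Lemma level_sum_weight_centers_broom : 2 * d.-1 < n ->
  level_sum (broom n d) (weight_centers (broom n d))
    = \sum_(i < d) (d.-1 - i) + (n - d).
Proof.
move=> dn2; have cn : d.-1 < n by lia.
rewrite (@weight_centers_broom (Ordinal cn)) // /level_sum.
transitivity (\sum_(u < n)
    (fun i => (d.-1 - i) + (i - d.-1)) (minn u d)).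
  apply: eq_bigr => u _; rewrite big_set1E dist_broom ?card_ord /=; last by lia.
  by broom_dist_lia.
rewrite (sum_minn (fun i => (d.-1 - i) + (i - d.-1))) //; last exact: ltnW.
by congr (_ + _); [apply: eq_bigr => i _; have := ltn_ord i|]; lia.
Qed.

(** The two terms come from vertex 0 and the leaf d. The distance 2 between leaves stays below the
    maximum because d > 1. *)
Lemma ecc_broom (v : 'I_n) :
  ecc (broom n d) v = maxn (minn v d) (d - minn v d).
Proof.
have dnP : 1 < d < n by lia.
apply/eqP; rewrite eqn_leq; apply/andP; split.
  apply/bigmax_leqP => u _; rewrite dist_broom //.
  by broom_dist_lia.
have n0 : 0 < n by lia.
rewrite geq_max; apply/andP; split.
  apply: leq_trans (leq_bigmax (Ordinal n0)); rewrite dist_broom //=.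
  by broom_dist_lia.
apply: leq_trans (leq_bigmax (Ordinal d_ltn)); rewrite dist_broom //=.
by broom_dist_lia.
Qed.

Lemma center_broom k e (v : 'I_n) : e <= 1 -> d = 2 * k + e ->
  (v \in center (broom n d)) = (k <= v <= k + e).
Proof.
move=> e1 dE; have kn : k < n by lia.
rewrite inE; apply/forallP/idP => [/(_ (Ordinal kn))|vP u].
  by rewrite !ecc_broom /=; lia.
by rewrite !ecc_broom /=; lia.
Qed.

Lemma level_sum_center_broom k e : e <= 1 -> d = 2 * k + e ->
  k * k + (n - d) * k <= level_sum (broom n d) (center (broom n d)).
Proof.
move=> e1 dE.
have -> : k * k + (n - d) * k = \sum_(u < n)
    (fun i => (k - i) + (i - (k + e))) (minn u d).
  rewrite (sum_minn (fun i => (k - i) + (i - (k + e)))); last exact: ltnW.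
  have := sum_dist_middle k e; rewrite -dE => ->.
  by congr (_ + _ * _); lia.
(* Every central vertex lies in [k, k+e], so it is at least as far from u as that interval is from
   the folded position of u. *)
apply: leq_sum => u _; apply: bigmin_ge; first by rewrite card_ord; lia.
move=> x; rewrite (center_broom _ e1 dE) => xP; rewrite dist_broom; last by lia.
by broom_dist_lia.
Qed.

Lemma bicentral_center_broom k : d = 2 * k + 1 ->
  bicentral (center (broom n d)) = 1.
Proof.
move=> dE; have kn : k < n by lia.
have kn1 : k.+1 < n by lia.
rewrite /bicentral.
suff -> : center (broom n d) = [set Ordinal kn; Ordinal kn1].
  by rewrite cards2 -(inj_eq val_inj) /=; lia.
apply/setP => v; rewrite (center_broom _ _ dE) // !inE -!(inj_eq val_inj) /=.
by lia.
Qed.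

End Broom.

Lemma double_order_broomB d : 2 * order_broomB d = d * d.+1.
Proof.
rewrite /order_broomB; have := odd_double_half d.
by case: (odd d) => /=; rewrite -muln2; nia.
Qed.

Theorem theorem6 (k d : nat) (hk : 1 <= k)
    (hd : d = 2 * k \/ d = 2 * k + 1) (hd3 : 3 <= d) :
  (lbW (broomB d) - lb (broomB d) > 0)%R.
Proof.
have [e e1 dE] : exists2 e, e <= 1 & d = 2 * k + e.
  by case: hd => ->; [exists 0; rewrite ?addn0|exists 1].
have n2 := double_order_broomB d.
rewrite /lbW /lb /lower_bound /broomB.
move: (order_broomB d) n2 => n n2.
have dd : d * d.+1 = d * d.-1 + 2 * d by case: d {hd hd3 dE n2} => //=; lia.
(* Here d >= 3 enters; it yields n >= 2d, hence the strict majority 2(d-1) < n. *)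
have dP : d * 2 <= d * d.-1 by rewrite leq_mul2l; lia.
have dn : d < n by lia.
have dn2 : 2 * d.-1 < n by lia.
have d1 : 1 < d by lia.
have LW := level_sum_weight_centers_broom d1 dn dn2.
have sum_rev := double_sum_rev d.
have L := level_sum_center_broom d1 dn e1 dE.
have cn : d.-1 < n by lia.
have zW : bicentral (weight_centers (broom n d)) = 0.
  by rewrite (@weight_centers_broom n d d1 dn (Ordinal cn)) // /bicentral cards1.
(* This range suffices: the difference of the bounds contains z n with a positive sign. *)
have z : e <= bicentral (center (broom n d)) <= 1.
  case: e e1 dE {L} => [|[|//]] _ dE; first by rewrite /= leq_b1.
  by rewrite (bicentral_center_broom d1 dn dE).
rewrite card_ord zW LW.
move: (bicentral _) (level_sum _ _) (\sum_(i < d) _) z L sum_rev {LW zW}.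
move=> z L S zP LP SP.
have key : 2 * (S + (n - d)) < z * n + 2 * L.
  have nd : 2 * (n - d) = d * d.-1 by lia.
  have {}LP : 2 * (k * k) + d * d.-1 * k <= 2 * L.
    by rewrite -nd; move: LP; lia.
  have -> : 2 * (S + (n - d)) = d * d.-1 * 2 by lia.
  (* For k >= 2 the term d(d-1)k alone covers 2d(d-1), and k^2 makes the inequality strict. For k =
     1, d = 3 and n = 6, and the term z n = 6 is what decides: 12 < 6 + 8. *)
  have [k1|k2] := leqP k 1.
    have kE : k = 1 by lia.
    have dE3 : d = 3 by lia.
    have zE : z = 1 by lia.
    by subst k d z; lia.
  have : d * d.-1 * 2 <= d * d.-1 * k by rewrite leq_mul2l k2 orbT.
  have : 0 < k * k by rewrite muln_gt0 hk.
  by lia.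
by case: z zP key => [|[|z]] zP key; lia.
Qed.
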